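(* Let $(\mathfrak h,(H_i,L_i)_{i\in I})$ be a linear Coxeter system with linear Coxeter group $\mathcal W$, closed fundamental chamber $\overline C$ and Tits cone $X$. Let $Y\subseteq X$ be a $\mathcal W$-invariant convex subcone containing $0$. The map $\upsilon:\Upsilon\to\mathcal P(I)$ is a regular type map, such that $\mathcal F(\Upsilon,\upsilon)$ is isomorphic to the face lattice $\mathrm{Fa}(Y)$.
   Context: $\mathbb R^+=(0,\infty)$. A convex cone is a subset of a real vector space closed under addition and under multiplication by elements of $\mathbb R^+$. $\mathrm{ri}$ denotes the relative interior of a finite-dimensional convex set. For a convex cone $K$ containing $0$, a face of $K$ is a convex cone $F\subseteq K$ with $(K\setminus F)+K\subseteq K\setminus F$; $\mathrm{Fa}(K)$ is the set of nonempty faces, ordered by inclusion (a complete lattice with meet given by intersection). Linear Coxeter systems. Let $\mathfrak h$ be a finite-dimensional real vector space, $n\ge1$, $I=\{1,\dots,n\}$. For a zero-based closed ray $H\subseteq\mathfrak h$ put $H^{\ge0}=\{\lambda\in\mathfrak h^*\mid\lambda(h)\ge0\ \forall h\in H\}$, $H^{>0}=\{\lambda\mid\lambda(h)>0\ \forall h\in H\setminus\{0\}\}$, $H^{=0}=\{\lambda\mid\lambda(h)=0\ \forall h\in H\}$. A linear Coxeter system $(\mathfrak h,(H_i,L_i)_{i\in I})$ consists of zero-based closed rays $H_i\subseteq\mathfrak h$, $L_i\subseteq\mathfrak h^*$ with $L_i\setminus\{0\}\subseteq H_i^{>0}$ such that: (1) the closed fundamental chamber $\overline C=\bigcap_{i\in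 I}H_i^{\ge0}$ spans $\mathfrak h^*$, and $\overline C\cap H_i^{=0}$, $i\in I$, are its pairwise different faces of codimension 1; (2) with $C=\bigcap_{i\in I}H_i^{>0}$ and $\mathcal W$ (the linear Coxeter group) the group generated by the reflections $\sigma_i$ on $\mathfrak h^*$ at the hyperplane $H_i^{=0}$ along the line $L_i\cup(-L_i)$, one has $\sigma C\cap C=\emptyset$ for all $\sigma\in\mathcal W\setminus\{1\}$. $\mathcal W_J$ is the subgroup generated by $\sigma_j$, $j\in J$. The Tits cone is the convex cone $X=\bigcup_{\sigma\in\mathcal W}\sigma\overline C$. $\Upsilon=\{R\in\mathrm{Fa}(Y)\mid\mathrm{ri}(R)\cap\overline C\ne\emptyset\}$, ordered by inclusion, and $\upsilon(R)=\{i\in I\mid\sigma_iR=R\}$ for $R\in\Upsilon$. $\mathcal P(I)$ is the power set of $I$. Regular type maps. Let $(\mathcal U,\le)$ be a lower semilattice (a partially ordered set with binary meets) with biggest element $1$. A map $\lambda:\mathcal U\to\mathcal P(I)$ with $\lambda(1)=I$ is called a regular type map if on the set $\mathcal F(\mathcal U,\lambda)=\{(u,\sigma\mathcal W_{\lambda(u)})\mid u\in\mathcal U,\ \sigma\in\mathcal W\}$ the relation $$(u_1,\sigma_1\mathcal W_{\lambda(u_1)})\le(u_2,\sigma_2\mathcal W_{\lambda(u_2)})\ :\iff\ u_1\le u_2\text{ and }\sigma_1\mathcal W_{\lambda(u_1)}\cap\sigma_2\mathcal W_{\lambda(u_2)}\ne\emptyset$$ is a partial order making $\mathcal F(\mathcal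 U,\lambda)$ a lower semilattice with biggest element $(1,\mathcal W)$. The isomorphism in the claim is one of partially ordered sets. *)

(* Defs.v *)
From HB Require Import structures.
From mathcomp Require Import all_boot all_order all_algebra.
From mathcomp Require Import all_classical all_reals topology normedtype.

Set Implicit Arguments.
Unset Strict Implicit.
Unset Printing Implicit Defensive.

Import Order.TTheory GRing.Theory Num.Theory.
Import numFieldNormedType.Exports VectorInternalTheory.

Local Open Scope classical_set_scope.
Local Open Scope ring_scope.

Notation dual h := 'Hom(h, _^o).

Section Convexity.
Context {R : realType} {V : vectType R}.
Implicit Types A K F : set V.

Definition convex_cone K : Prop :=
  (forall x y, K x -> K y -> K (x + y)) /\
  (forall (t : R) x, 0 < t -> K x -> K (t *: x)).

Definition affine_hull A : set V :=
  [set x | exists (m : nat) (a : 'I_m -> R) (p : 'I_m -> V),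
     [/\ forall i, A (p i), \sum_i a i = 1 & x = \sum_i a i *: p i]].

(* An abstract vectType carries no topology: neighbourhoods are those of the
   row vectors of coordinates, through the linear isomorphism v2r. *)
Definition relative_interior A : set V :=
  [set x | A x /\
     \forall u \near v2r x, affine_hull A (r2v u) -> A (r2v u)].

Definition has_dim A (d : nat) : Prop :=
  exists (x : V) (U : {vspace V}),
    affine_hull A = [set x + u | u in [set u | u \in U]] /\ \dim U = d.

Definition spanning A : Prop :=
  forall U : {vspace V}, (forall x, A x -> x \in U) -> U = fullv.

Definition is_face K F : Prop :=
  [/\ convex_cone F, F `<=` K &
      forall x y, (K `\` F) x -> K y -> (K `\` F) (x + y)].

Definition Fa K : set (set V) := [set F | is_face K F /\ F !=set0].

Definition codim1_face K F : Prop :=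
  Fa K F /\ exists d : nat, has_dim F d /\ has_dim K d.+1.

Definition closed_ray (A : set V) : Prop :=
  exists v : V, v != 0 /\ A = [set t *: v | t in [set t : R | 0 <= t]].

Definition is_subgroup (M : set 'End(V)) : Prop :=
  [/\ forall s, M s -> lker s == 0%VS,
      M \1%VF,
      forall s t, M s -> M t -> M (s \o t)%VF &
      forall s, M s -> M (s^-1)%VF].

Definition generated_group (S : set 'End(V)) : set 'End(V) :=
  smallest is_subgroup S.

End Convexity.

Section Rays.
Context {R : realType} {h : vectType R}.
Implicit Types (H : set h) (L : set (dual h)).

Definition ray_ge0 H : set (dual h) :=
  [set l | forall x, H x -> (0 : R) <= l x].
Definition ray_gt0 H : set (dual h) :=
  [set l | forall x, (H `\ 0) x -> (0 : R) < l x].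
Definition ray_eq0 H : set (dual h) :=
  [set l | forall x, H x -> l x = 0].

Definition is_reflection H L (s : 'End(dual h)) : Prop :=
  (forall l, ray_eq0 H l -> s l = l) /\
  (forall l, (L `|` [set - m | m in L]) l -> s l = - l).

(* is_reflection H L has exactly one solution as soon as H and L are closed
   rays and L `\ 0 `<=` ray_gt0 H: see reflectionP and reflection_unique. *)
Definition reflection H L : 'End(dual h) := xget \1%VF (is_reflection H L).

Lemma ray_mem (W : lmodType R) (w : W) :
  [set t *: w | t in [set t : R | 0 <= t]] w.
Proof. by exists 1; rewrite /= ?ler01 ?scale1r. Qed.

Lemma ray_pairing_neq0 H L (v : h) (m : dual h) : v != 0 -> m != 0 ->
  H = [set t *: v | t in [set t : R | 0 <= t]] ->
  L = [set t *: m | t in [set t : R | 0 <= t]] ->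
  L `\ 0 `<=` ray_gt0 H -> (m v : R) != 0.
Proof.
move=> v0 m0 HE LE LH; suff /lt0r_neq0 : (0 : R) < m v by [].
apply: (LH m); split.
- by rewrite LE; exact: ray_mem.
- exact/eqP.
- by rewrite HE; exact: ray_mem.
- exact/eqP.
Qed.

Lemma is_reflectionE (v : h) (m : dual h) (s : 'End(dual h)) :
  (m v : R) != 0 ->
  is_reflection [set t *: v | t in [set t : R | 0 <= t]]
                [set t *: m | t in [set t : R | 0 <= t]] s <->
  forall l : dual h, s l = l - (2 * ((l v : R) / m v)) *: m.
Proof.
move=> mv0; split=> [[s1 s2] l|sE].
- have mE : s m = - m by apply: s2; left; exact: ray_mem.
  set k : R := (l v : R) / m v.
  have /s1 : ray_eq0 [set t *: v | t in [set t : R | 0 <= t]] (l - k *: m).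
    move=> _ [t _ <-]; rewrite linearZ/= add_lfunE opp_lfunE scale_lfunE.
    suff -> : l v - k *: m v = 0 by rewrite scaler0.
    by rewrite /k -[_ *: _]/(_ * _) divfK// subrr.
  rewrite linearB linearZ/= mE scalerN opprK => e.
  by rewrite -(addrK (k *: m) (s l)) e -addrA -opprD -scalerDl mulrDl !mul1r.
- split=> l.
    move=> l0; rewrite sE.
    have -> : (l v : R) = 0 by apply: l0; exact: ray_mem.
    by rewrite mul0r mulr0 scale0r subr0.
  suff sm (t : R) : s (t *: m) = - (t *: m).
    move=> [[t _ <-]|[_ [t _ <-] <-]]; first exact: sm.
    by rewrite [LHS]raddfN; congr (- _); exact: sm.
  rewrite [LHS]linearZ/= sE divff// mulr1 -[RHS]scalerN; congr (_ *: _).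
  by rewrite scaler_nat mulr2n opprD addrA subrr add0r.
Qed.

Lemma reflectionP H L : closed_ray H -> closed_ray L ->
  L `\ 0 `<=` ray_gt0 H -> is_reflection H L (reflection H L).
Proof.
move=> [v [v0 HE]] [m [m0 LE]] LH.
have mv : (m v : R) != 0 by exact: (@ray_pairing_neq0 H L).
pose g (l : dual h) : dual h := l - (2 * ((l v : R) / m v)) *: m.
have g_lin : linear g.
  move=> a x y; rewrite /g.
  have -> : 2 * (((a *: x + y) v : R) / m v) =
            a * (2 * ((x v : R) / m v)) + 2 * ((y v : R) / m v).
    rewrite add_lfunE scale_lfunE -[_ *: _]/(a * x v : R).
    by rewrite [((_ : R) + _) / _]mulrDl mulrDr -mulrA [in LHS]mulrCA.
  by rewrite scalerDl opprD addrACA scalerBr scalerA.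
pose gL : {linear dual h -> dual h} :=
  HB.pack g (GRing.isLinear.Build _ _ _ _ g g_lin).
apply: (@xgetPex _ _ (is_reflection H L)); exists (linfun gL).
by rewrite HE LE; apply/is_reflectionE => // l; rewrite lfunE.
Qed.

Lemma reflection_unique H L (s t : 'End(dual h)) :
  closed_ray H -> closed_ray L -> L `\ 0 `<=` ray_gt0 H ->
  is_reflection H L s -> is_reflection H L t -> s = t.
Proof.
move=> [v [v0 HE]] [m [m0 LE]] LH.
have mv : (m v : R) != 0 by exact: (@ray_pairing_neq0 H L).
by rewrite HE LE => /(is_reflectionE _ mv) sE /(is_reflectionE _ mv) tE;
   apply/lfunP => l; rewrite sE tE.
Qed.

End Rays.

Section Coxeter.
Context {R : realType} {h : vectType R} {n : nat}.
Variables (H : 'I_n -> set h) (L : 'I_n -> set (dual h)).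

Definition closed_chamber : set (dual h) := \bigcap_(i in setT) ray_ge0 (H i).
Definition chamber : set (dual h) := \bigcap_(i in setT) ray_gt0 (H i).
Definition wall (i : 'I_n) : set (dual h) := closed_chamber `&` ray_eq0 (H i).

Definition sigma (i : 'I_n) : 'End(dual h) := reflection (H i) (L i).
Definition parabolic (J : set 'I_n) : set 'End(dual h) :=
  generated_group (sigma @` J).
Definition coxeter_group : set 'End(dual h) := parabolic setT.

Record linear_coxeter_system : Prop := LinearCoxeterSystem {
  lcs_rank : (0 < n)%N;
  lcs_rayH : forall i, closed_ray (H i);
  lcs_rayL : forall i, closed_ray (L i);
  lcs_pos : forall i, L i `\ 0 `<=` ray_gt0 (H i);
  lcs_span : spanning closed_chamber;
  lcs_wall_inj : injective wall;
  lcs_walls : range wall = [set F | codim1_face closed_chamber F];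
  lcs_disjoint : forall s, coxeter_group s -> s <> \1%VF ->
    (s @` chamber) `&` chamber = set0 }.

Definition tits_cone : set (dual h) :=
  \bigcup_(s in coxeter_group) (s @` closed_chamber).

Definition Upsilon (Y : set (dual h)) : set (set (dual h)) :=
  [set F | Fa Y F /\ relative_interior F `&` closed_chamber !=set0].

Definition upsilon (F : set (dual h)) : set 'I_n :=
  [set i | sigma i @` F = F].

Definition left_coset (s : 'End(dual h)) (M : set 'End(dual h)) :=
  [set (s \o t)%VF | t in M].

End Coxeter.

Section Posets.
Context {T T' : Type}.
Implicit Types (A : set T) (le : T -> T -> Prop).

Definition partial_order_on A le : Prop :=
  [/\ forall x, A x -> le x x,
      forall x y, A x -> A y -> le x y -> le y x -> x = y &
      forall x y z, A x -> A y -> A z -> le x y -> le y z -> le x z].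

Definition is_meet A le (x y m : T) : Prop :=
  [/\ A m, le m x, le m y & forall z, A z -> le z x -> le z y -> le z m].

Definition lower_semilattice_with_top A le (top : T) : Prop :=
  [/\ partial_order_on A le,
      forall x y, A x -> A y -> exists m, is_meet A le x y m,
      A top & forall x, A x -> le x top].

Definition poset_isomorphic A le (B : set T') (le' : T' -> T' -> Prop) : Prop :=
  exists f : T -> T', set_bij A B f /\
    forall x y, A x -> A y -> (le x y <-> le' (f x) (f y)).

End Posets.

Section TypeMaps.
Context {R : realType} {h : vectType R} {n : nat}.
Variables (H : 'I_n -> set h) (L : 'I_n -> set (dual h)).
Context {T : Type}.
Variables (U : set T) (le : T -> T -> Prop) (top : T) (lam : T -> set 'I_n).

Definition type_poset : set (T * set 'End(dual h)) :=
  [set p | U p.1 /\ exists2 s, coxeter_group H L s &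
     p.2 = left_coset s (parabolic H L (lam p.1))].

Definition type_poset_le (p q : T * set 'End(dual h)) : Prop :=
  le p.1 q.1 /\ p.2 `&` q.2 !=set0.

Definition regular_type_map : Prop :=
  [/\ lower_semilattice_with_top U le top,
      lam top = setT &
      lower_semilattice_with_top type_poset type_poset_le
        (top, coxeter_group H L)].

End TypeMaps.

(* Main.v *)
(* The map (F, sW) |-> sF is the isomorphism onto the face lattice. It is onto
   because a relative interior point of a face can be moved into the closed
   chamber. Everything else follows from one statement: if F and F' are faces
   whose relative interiors meet the closed chamber and wF is contained in F',
   then F is contained in F' and w lies in W_F' W_F, where W_F is generated by
   the simple reflections fixing F. This goes by induction on the length of w.
   Choose a wall i of C separating C from wC, and points x, y of the closed
   chamber in ri F and ri F'. Then the functional a_i is nonnegative at y and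
   nonpositive at wx, so either it vanishes at wx, and s_i fixes the face wF,
   or it vanishes at a point of ri F' between them, and s_i fixes F'; in both
   cases one passes to the shorter element s_i w. That s_i w is shorter is the
   exchange condition, which comes from the disjointness of the chambers: the
   hyperplane of s_i cuts no chamber, hence is crossed by any gallery from C to
   wC at the common wall of two consecutive chambers. *)

From HB Require Import structures.
Require Import Defs.
From mathcomp Require Import all_boot all_order all_algebra.
From mathcomp Require Import all_classical all_reals topology normedtype.
From mathcomp Require Import ring lra.

Set Implicit Arguments.
Unset Strict Implicit.
Unset Printing Implicit Defensive.

Import Order.TTheory GRing.Theory Num.Theory.
Import numFieldNormedType.Exports VectorInternalTheory.

Local Open Scope classical_set_scope.
Local Open Scope ring_scope.

(** * Relative interiors and faces of cones *)

Section ConeInterior.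
Context {R : realType} {V : vectType R}.
Implicit Types K F A : set V.

(* For cones containing 0 this algebraic description agrees with the
   topological relative interior: see [relative_interiorE]. *)
Definition cone_ri F : set V :=
  [set x | F x /\ forall y, F y -> exists2 e : R, 0 < e & F (x - e *: y)].

Lemma cone_scale_ge0 F (t : R) x :
  convex_cone F -> F 0 -> 0 <= t -> F x -> F (t *: x).
Proof.
move=> [_ cF] F0; rewrite le_eqVlt => /predU1P[<- _|t0 Fx].
  by rewrite scale0r.
exact: cF.
Qed.

Lemma cone_sum F I (r : seq I) (P : pred I) (G : I -> V) :
  convex_cone F -> F 0 -> (forall i, P i -> F (G i)) ->
  F (\sum_(i <- r | P i) G i).
Proof.
by move=> [aF _] F0 FG; elim/big_ind: _ => // x y; exact: aF.
Qed.

Lemma cone_riD F x y : convex_cone F -> cone_ri F x -> F y -> cone_ri F (x + y).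
Proof.
move=> [aF cF] [Fx rx] Fy; split; first exact: aF.
move=> z /rx[e e0 Fe]; exists e => //.
by rewrite addrAC; apply: aF.
Qed.

Lemma cone_riZ F (t : R) x : convex_cone F -> 0 < t -> cone_ri F x ->
  cone_ri F (t *: x).
Proof.
move=> [aF cF] t0 [Fx rx]; split; first exact: cF.
move=> z /rx[e e0 Fe]; exists (t * e); first exact: mulr_gt0.
by rewrite -scalerA -scalerBr; apply: cF.
Qed.

Lemma exists_spanning_seq F :
  exists X : seq V, (forall x, x \in X -> F x) /\
    forall y, F y -> y \in <<X>>%VS.
Proof.
suff H k : exists X : seq V, (forall x, x \in X -> F x) /\
    ((forall y, F y -> y \in <<X>>%VS) \/ (k <= \dim <<X>>)%N).
  have [X [FX [|/leq_trans/(_ (dimvS (subvf _)))]]] := H (\dim {: V}).+1.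
    by exists X.
  by rewrite ltnn.
elim: k => [|k [X [FX [XF|kX]]]].
- by exists [::]; split => //; right.
- by exists X; split => //; left.
- have [XF|/existsNP[y /not_implyP[Fy /negP yX]]] :=
    pselect (forall y, F y -> y \in <<X>>%VS).
    by exists X; split => //; left.
  exists (y :: X); split.
    by move=> x; rewrite inE => /predU1P[->//|/FX].
  right; rewrite span_cons; apply: (leq_ltn_trans kX).
  rewrite ltnNge; apply/negP => le.
  have e : (<<X>> == <[y]> + <<X>>)%VS by rewrite eqEdim addvSr.
  by move/negP: yX; apply; rewrite (eqP e) memvE addvSl.
Qed.

Lemma cone_ri_neq0 F : convex_cone F -> F 0 -> cone_ri F !=set0.
Proof.
move=> cF F0; have [X [FX spX]] := exists_spanning_seq F.
pose n := size X; pose Xt : n.-tuple V := in_tuple X.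
have FXi (i : 'I_n) : F X`_i by apply: FX; rewrite mem_nth.
exists (\sum_(i < n) X`_i); split; first exact: cone_sum.
move=> y /spX yX; rewrite [y](@coord_span _ _ n Xt)//.
pose B := 1 + \sum_(i < n) `|coord Xt i y|.
have S0 : 0 <= \sum_(i < n) `|coord Xt i y| by apply: sumr_ge0.
have B0 : 0 < B by rewrite /B; lra.
exists B^-1; first by rewrite invr_gt0.
rewrite scaler_sumr -sumrB; apply: cone_sum => // i _.
rewrite scalerA -{1}(scale1r X`_i) -scalerBl; apply: cone_scale_ge0 => //.
rewrite subr_ge0 mulrC ler_pdivrMr// mul1r.
apply: (le_trans (ler_norm _)); rewrite /B (bigD1 i)//=.
have : 0 <= \sum_(j < n | j != i) `|coord Xt j y| by apply: sumr_ge0.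
have : 0 <= `|coord Xt i y| by [].
lra.
Qed.

Lemma mem_row_near (m : nat) (u w : 'rV[R]_m) (P : set 'rV[R]_m) :
  (\forall z \near u, P z) -> exists2 e : R, 0 < e & P (u - e *: w).
Proof.
move=> /nbhs_ballP[e /= e0 eP].
pose B := 1 + \sum_(i < m) `|w 0 i|.
have S0 : 0 <= \sum_(i < m) `|w 0 i| by apply: sumr_ge0.
have B0 : 0 < B by rewrite /B; lra.
exists (e / B); first exact: divr_gt0.
apply: eP; split => // i j; rewrite (ord1 i) !mxE -ball_normE /=.
rewrite opprB addrC subrK normrM ger0_norm ?divr_ge0 ?ltW//.
rewrite mulrAC ltr_pdivrMr// ltr_pM2l// /B (bigD1 j)//=.
have : 0 <= \sum_(k < m | k != j) `|w 0 k| by apply: sumr_ge0.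
lra.
Qed.

Lemma relative_interiorE F : convex_cone F -> F 0 ->
  relative_interior F = cone_ri F.
Proof.
move=> cF F0; apply/seteqP; split => x [Fx]; last first.
  move=> rx; split=> //.
  have [X [FX spX]] := exists_spanning_seq F.
  pose n := size X; pose Xt : n.-tuple V := in_tuple X.
  have FXi (i : 'I_n) : F X`_i by apply: FX; rewrite mem_nth.
  have [|e e0 Fe] := rx (\sum_(i < n) X`_i); first exact: cone_sum.
  pose D := \sum_(i < n) \sum_(j < dim V) `|coord Xt i (r2v (delta_mx 0 j))|.
  have D0 : 0 <= D by apply: sumr_ge0 => i _; apply: sumr_ge0.
  pose B := 1 + D.
  have B0 : 0 < B by rewrite /B; lra.
  apply/nbhs_ballP; exists (e / B) => /=; first exact: divr_gt0.
  move=> u [_ xu] aff.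
  have uX : r2v u \in <<X>>%VS.
    have [k [c [p [Fp _ ->]]]] := aff.
    by apply: memv_suml => i _; apply: memvZ; apply: spX.
  have yX : r2v u - x \in <<X>>%VS by rewrite rpredB// spX.
  pose c i := coord Xt i (r2v u - x).
  have -> : r2v u = (x - e *: (\sum_(i < n) X`_i)) +
                     \sum_(i < n) (e + c i) *: X`_i.
    rewrite scaler_sumr; under [X in _ + X]eq_bigr do rewrite scalerDl.
    rewrite big_split/= addrA subrK -(coord_span (X:=Xt))//.
    by rewrite addrC subrK.
  have [aF _] := cF; apply: aF => //; apply: cone_sum => // i _.
  apply: cone_scale_ge0 => //.
  suff : `|c i| <= e by rewrite ler_norml => /andP[]; lra.
  rewrite /c -{1}(v2rK x) -linearB/= [_ - _]row_sum_delta !linear_sum/=.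
  apply: (le_trans (ler_norm_sum _ _ _)).
  have -> : e = (e / B) * B by rewrite divfK// gt_eqF.
  apply: (@le_trans _ _ ((e / B) * D)); last first.
    by rewrite ler_pM2l ?divr_gt0// /B; lra.
  rewrite /D (bigD1 i)//= mulrDr.
  apply: (@le_trans _ _ ((e / B) *
    \sum_(j < dim V) `|coord Xt i (r2v (delta_mx 0 j))|)); last first.
    rewrite lerDl mulr_ge0 ?divr_ge0 ?(ltW e0) ?(ltW B0)//.
    by apply: sumr_ge0 => k _; apply: sumr_ge0.
  rewrite mulr_sumr; apply: ler_sum => j _.
  rewrite !linearZ/= normrM ler_wpM2r// ltW//.
  by have := xu 0 j; rewrite -ball_normE /= distrC !mxE.
move=> nx; split=> // y Fy.
have [e e0] := mem_row_near (v2r y) nx.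
rewrite -linearZ -linearB v2rK => Fe; exists e => //; apply: Fe.
exists 3, (fun i : 'I_3 => [:: 1 + e + e; - e; - e]`_i),
  (fun i : 'I_3 => [:: x; x + x; y]`_i); split.
- by case; case=> [//|[|[|//]]] ? //=; apply: cF.1.
- rewrite !big_ord_recl big_ord0 /=; lra.
- rewrite !big_ord_recl big_ord0 /= addr0 !scalerDl !scaleNr scalerDr scale1r.
  by rewrite [RHS]addrA opprD !addrA; congr (_ - _); rewrite addrAC addrK addrK.
Qed.

Lemma face0 K F : K 0 -> Fa K F -> F 0.
Proof.
move=> K0 [[_ FK abs] [x Fx]]; apply: contrapT => nF0.
have [|_] := abs 0 x _ (FK _ Fx); first by [].
by rewrite add0r.
Qed.

Lemma face_sub K F F' x : Fa K F -> Fa K F' -> cone_ri F x -> F' x -> F `<=` F'.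
Proof.
move=> [[cF FK _] _] [[cF' _ abs] _] [Fx rx] F'x y Fy.
have [e e0 Fz] := rx _ Fy; apply: contrapT => nF'y.
suff [_ []] : (K `\` F') (e *: y + (x - e *: y)) by rewrite addrC subrK.
apply: abs; last exact: FK.
split=> [|F'ey]; first by apply: FK; apply: cF.2.
apply: nF'y; have -> : y = e^-1 *: (e *: y).
  by rewrite scalerA mulVf ?scale1r// gt_eqF.
by apply: cF'.2 => //; rewrite invr_gt0.
Qed.

Lemma face_eq K F F' x :
  Fa K F -> Fa K F' -> cone_ri F x -> cone_ri F' x -> F = F'.
Proof.
move=> fF fF' rF rF'; apply/seteqP; split.
  exact: (face_sub fF fF' rF rF'.1).
exact: (face_sub fF' fF rF' rF.1).
Qed.

Lemma face_refl K : convex_cone K -> K 0 -> Fa K K.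
Proof. by move=> cK K0; split; [split=> // x y []|exists 0]. Qed.

Lemma faceI K F F' : convex_cone K -> K 0 -> Fa K F -> Fa K F' ->
  Fa K (F `&` F').
Proof.
move=> cK K0 fF fF'; split; last by exists 0; split; apply: face0; eauto.
move: fF fF' => [[cF FK aF] _] [[cF' FK' aF'] _]; split.
- split=> [x y [Fx Fx'] [Fy Fy']|t x t0 [Fx Fx']].
    by split; [apply: cF.1|apply: cF'.1].
  by split; [apply: cF.2|apply: cF'.2].
- by move=> x [/FK].
- move=> x y [Kx nF] Ky; split; first exact: cK.1.
  have [Fx|nFx] := pselect (F x); last first.
    by move=> [Fxy _]; have [] := aF x y (conj Kx nFx) Ky.
  have nFx' : ~ F' x by move=> Fx'; apply: nF.
  by move=> [_ Fxy]; have [] := aF' x y (conj Kx nFx') Ky.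
Qed.

Lemma cone_ri_kernel (f : {scalar V}) F x y : convex_cone F ->
  cone_ri F x -> F y -> 0 <= f x -> f y < 0 ->
  exists2 z, cone_ri F z & f z = 0.
Proof.
move=> cF rx Fy; rewrite le_eqVlt => /predU1P[fx _|fx fy].
  by exists x.
exists ((- f y) *: x + f x *: y).
  apply: cone_riD => //; last exact: cF.2.
  by apply: cone_riZ; rewrite ?oppr_gt0.
by rewrite linearD !linearZ/=; ring.
Qed.

Section LinearImages.
Variables f g : 'End(V).
Hypothesis fK : cancel f g.

Lemma lfun_cone F : convex_cone F -> convex_cone (f @` F).
Proof.
move=> [aF cF]; split=> [_ _ [x Fx <-] [y Fy <-]|t _ t0 [x Fx <-]].
  by exists (x + y); [exact: aF|rewrite linearD].
by exists (t *: x); [exact: cF|rewrite linearZ].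
Qed.

Lemma cone_ri_image F x : cone_ri F x -> cone_ri (f @` F) (f x).
Proof.
move=> [Fx rx]; split; first by exists x.
move=> _ [y /rx[e e0 Fe] <-]; exists e => //.
by exists (x - e *: y) => //; rewrite linearB linearZ.
Qed.

Lemma Fa_image K F : f @` K = K -> Fa K F -> Fa K (f @` F).
Proof.
move=> KE [[cF FK aF] [x Fx]]; split; last by exists (f x), x.
split; first exact: lfun_cone.
  by move=> _ [y /FK Ky <-]; rewrite -KE; exists y.
move=> y z; rewrite -{1 2 3}KE => -[[y' Ky <-]] nF [z' Kz <-].
have [|Kyz nyz] := aF y' z' _ Kz; first by split=> // Fy; apply: nF; exists y'.
rewrite -linearD; split; first by exists (y' + z').
by move=> [w Fw /(can_inj fK) wE]; apply: nyz; rewrite -wE.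
Qed.

End LinearImages.

End ConeInterior.
(** * The exchange condition *)

Lemma small_perturbation (R : realFieldType) (n : nat) (P : pred 'I_n)
    (u w : 'I_n -> R) : (forall j, P j -> 0 < u j) ->
  exists2 e, 0 < e & forall j, P j -> 0 < u j + e * w j.
Proof.
move=> u0; pose B := 1 + \sum_(j < n | P j) `|w j| / u j.
have S0 (Q : pred 'I_n) : 0 <= \sum_(j < n | P j && Q j) `|w j| / u j.
  by apply: sumr_ge0 => j /andP[/u0 uj _]; rewrite divr_ge0// ltW.
have B0 : 0 < B.
  by have := S0 predT; under eq_bigl do rewrite andbT; rewrite /B; lra.
exists B^-1 => [|j Pj]; first by rewrite invr_gt0.
rewrite -(pmulr_rgt0 _ B0) mulrDr mulrA divff ?gt_eqF// mul1r.
have uj := u0 _ Pj; have S := S0 (predC1 j).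
rewrite /B (bigD1 j Pj) /=; move: S => /=; set T := \sum_(_ < n | _) _ => S.
rewrite mulrDl mulrDl divfK ?gt_eqF// mul1r.
have := mulr_ge0 S (ltW uj).
have : - w j <= `|w j| by rewrite -normrN ler_norm.
lra.
Qed.

Section ReflectionSystem.
Context {R : realType} {V : vectType R} {n : nat}.
Variables (a : 'I_n -> {scalar V}) (s : 'I_n -> 'End(V)).
Implicit Types (w : seq 'I_n) (i j k : 'I_n) (x y : V) (F Y : set V).

Definition word_prod w : 'End(V) := foldr (fun i f => (s i \o f)%VF) \1%VF w.

Definition word_group (J : set 'I_n) : set 'End(V) :=
  [set word_prod w | w in [set w : seq 'I_n | forall i, i \in w -> J i]].

Definition in_chamber x : Prop := forall i, 0 < a i x.
Definition in_closed_chamber x : Prop := forall i, 0 <= a i x.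

Record reflection_system : Prop := ReflectionSystem {
  rs_opp : forall i x, a i (s i x) = - a i x;
  rs_fix : forall i x, a i x = 0 -> s i x = x;
  rs_invol : forall i x, s i (s i x) = x;
  rs_chamber : exists c, in_chamber c;
  rs_wall : forall i, exists2 p, a i p = 0 & forall j, j != i -> 0 < a j p;
  rs_disjoint : forall w x, in_chamber x -> in_chamber (word_prod w x) ->
    word_prod w = \1%VF }.

Hypothesis rs : reflection_system.

Lemma word_prod_cons i w x : word_prod (i :: w) x = s i (word_prod w x).
Proof. by rewrite /= comp_lfunE. Qed.

Lemma word_prod_cat w w' x :
  word_prod (w ++ w') x = word_prod w (word_prod w' x).
Proof. by elim: w => [|i w IH]/=; rewrite ?id_lfunE// !comp_lfunE /= IH. Qed.

Lemma word_prod_revK w : cancel (word_prod w) (word_prod (rev w)).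
Proof.
elim: w => [|i w IH] x; first by rewrite /rev/= !id_lfunE.
rewrite rev_cons -cats1 word_prod_cat !word_prod_cons id_lfunE (rs_invol rs).
exact: IH.
Qed.

Lemma word_prodK_rev w : cancel (word_prod (rev w)) (word_prod w).
Proof. by move=> x; rewrite -{1}(revK w) word_prod_revK. Qed.

Lemma word_groupM J f g :
  word_group J f -> word_group J g -> word_group J (f \o g)%VF.
Proof.
move=> [w wJ <-] [w' wJ' <-]; exists (w ++ w').
  by move=> i; rewrite mem_cat => /orP[/wJ|/wJ'].
by apply/lfunP => x; rewrite word_prod_cat comp_lfunE.
Qed.

Lemma word_group_gen J i : J i -> word_group J (s i).
Proof.
move=> Ji; exists [:: i] => [j|]; first by rewrite inE => /eqP ->.
by apply/lfunP => x; rewrite word_prod_cons id_lfunE.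
Qed.

Lemma word_group_subgroup J : is_subgroup (word_group J).
Proof.
have k0 w : lker (word_prod w) == 0%VS.
  by apply/lker0P; apply: can_inj (word_prod_revK w).
split=> [_ [w _ <-]//||f g|_ [w wJ <-]].
- by exists [::].
- exact: word_groupM.
- exists (rev w) => [i|]; first by rewrite mem_rev => /wJ.
  by apply/lfunP => x; rewrite -{2}(word_prodK_rev w x) lker0_lfunK.
Qed.

Lemma generated_groupE J : generated_group (s @` J) = word_group J.
Proof.
apply/seteqP; split.
  apply: smallest_sub; first exact: word_group_subgroup.
  by move=> _ [i Ji <-]; exact: word_group_gen.
move=> _ [w wJ <-] M [[_ M1 MM _] sM].
elim: w wJ => [//|i w IH] wJ; apply: MM.
  by apply: sM; exists i => //; apply: wJ; rewrite mem_head.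
by apply: IH => j jw; apply: wJ; rewrite inE jw orbT.
Qed.

Lemma closed_chamber_ge0 (f : {scalar V}) x :
  (forall y, in_chamber y -> 0 < f y) -> in_closed_chamber x -> 0 <= f x.
Proof.
move=> fC Cx; have [c Cc] := rs_chamber rs.
rewrite leNgt; apply/negP => fx.
suff : 0 < f ((- f x) *: c + f c *: x) by rewrite linearD !linearZ/=; lra.
apply: (fC) => i; rewrite linearD !linearZ/=.
apply: ltr_pwDl; first by rewrite mulr_gt0 ?oppr_gt0.
by rewrite mulr_ge0// ltW// fC.
Qed.

Lemma chamber_sign w i :
  (forall x, in_chamber x -> 0 < a i (word_prod w x)) \/
  (forall x, in_chamber x -> a i (word_prod w x) < 0).
Proof.
have [c Cc] := rs_chamber rs.
have n0 x : in_chamber x -> a i (word_prod w x) <> 0.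
  move=> Cx /(rs_fix rs) e.
  have g1 : word_prod (rev w ++ i :: w) = \1%VF.
    apply: (rs_disjoint rs Cx).
    by rewrite word_prod_cat word_prod_cons e word_prod_revK.
  have := rs_opp rs i c.
  have -> : s i c = c.
    apply: (can_inj (word_prod_revK (rev w))).
    have := word_prod_cat (rev w) (i :: w) (word_prod (rev w) c).
    by rewrite g1 id_lfunE word_prod_cons word_prodK_rev.
  have := Cc i; lra.
pose f : {scalar V} := a i \o word_prod w.
have fE x : f x = a i (word_prod w x) by [].
have neq x y : in_chamber x -> in_chamber y -> 0 < f x -> f y < 0 -> False.
  move=> Cx Cy fx fy; apply: (n0 ((- f y) *: x + f x *: y)).
    by move=> j; rewrite linearD !linearZ/= addr_gt0// mulr_gt0 ?oppr_gt0.
  by rewrite -fE linearD !linearZ/=; ring.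
have [f0|f0|/(n0 _ Cc)//] := ltgtP (f c) 0.
- right=> x Cx; rewrite -fE ltNge; apply/negP.
  rewrite le_eqVlt => /predU1P[/esym/(n0 _ Cx)//|fx]; exact: (neq x c).
- left=> x Cx; rewrite -fE ltNge; apply/negP.
  rewrite le_eqVlt => /predU1P[/(n0 _ Cx)//|fx]; exact: (neq c x).
Qed.

Lemma separating_functional k (f : {scalar V}) :
  (forall x, in_chamber x -> 0 < f x) ->
  (forall x, in_chamber x -> f (s k x) < 0) ->
  exists2 t, 0 < t & forall x, f x = t * a k x.
Proof.
move=> fC fsC; have [c Cc] := rs_chamber rs; have [p kp jp] := rs_wall rs k.
have Cp : in_closed_chamber p.
  by move=> j; have [->|/jp/ltW//] := eqVneq j k; rewrite kp.
have fp : f p = 0.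
  apply/eqP; rewrite eq_le (closed_chamber_ge0 fC Cp) andbT -oppr_ge0.
  pose g : {scalar V} := \- f \o s k.
  have -> : - f p = g p by rewrite /g/= (rs_fix rs).
  by apply: closed_chamber_ge0 => // x Cx; rewrite /g/= oppr_gt0 fsC.
have kerf q : a k q = 0 -> 0 <= f q.
  move=> kq; have [e e0 ep] := small_perturbation (fun j => a j q) jp.
  rewrite -(pmulr_rge0 _ e0); have -> : e * f q = f (p + e *: q).
    by rewrite linearD linearZ/= fp add0r.
  apply: closed_chamber_ge0 => // j; rewrite linearD linearZ/=.
  by have [->|/ep/ltW//] := eqVneq j k; rewrite kp kq mulr0 addr0.
exists (f c / a k c) => [|x]; first by rewrite divr_gt0// fC.
pose q := x - (a k x / a k c) *: c.
have kq : a k q = 0.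
  by rewrite /q linearB linearZ/= divfK ?subrr// gt_eqF.
have : f q = 0.
  apply/eqP; rewrite eq_le kerf// andbT -oppr_ge0 -linearN kerf//.
  by rewrite linearN kq oppr0.
rewrite /q linearB linearZ/= => /eqP; rewrite subr_eq0 => /eqP ->; ring.
Qed.

Lemma crossing w i k :
  (forall x, in_chamber x -> 0 < a i (word_prod w x)) ->
  (forall x, in_chamber x -> a i (word_prod (rcons w k) x) < 0) ->
  word_prod (i :: w) = word_prod (rcons w k).
Proof.
move=> wp wn; have [c Cc] := rs_chamber rs; have [p ip jp] := rs_wall rs i.
have [|x Cx|t t0 ft] := @separating_functional k (a i \o word_prod w).
- exact: wp.
- by have := wn x Cx; rewrite -cats1 word_prod_cat word_prod_cons id_lfunE.
rewrite /= in ft.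
have aE x : a i x = t * a k (word_prod (rev w) x) by rewrite -ft word_prodK_rev.
pose g := word_prod (i :: rcons w k ++ rev w).
have gE x : g x = s i (word_prod w (s k (word_prod (rev w) x))).
  rewrite /g word_prod_cons word_prod_cat -cats1 word_prod_cat.
  by rewrite word_prod_cons id_lfunE.
have gp : g p = p.
  rewrite gE (rs_fix rs (i := k)) ?word_prodK_rev ?(rs_fix rs)//.
  by move/eqP: ip; rewrite aE mulf_eq0 gt_eqF//= => /eqP.
have gc : a i (g c) = a i c.
  by rewrite gE (rs_opp rs) ft (rs_opp rs) mulrN opprK aE.
have [e e0 ep] := small_perturbation (fun j => a j (g c)) jp.
have /lfunP g1 : g = \1%VF.
  apply: (@rs_disjoint rs _ (p + e *: c)) => j.
    rewrite linearD linearZ/=; have [->|ji] := eqVneq j i.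
      by rewrite ip add0r mulr_gt0.
    by rewrite addr_gt0 ?jp// mulr_gt0.
  rewrite linearD linearZ/= -/g gp linearD linearZ/=.
  by have [->|/ep//] := eqVneq j i; rewrite ip add0r gc mulr_gt0.
apply/lfunP => y; rewrite -cats1 word_prod_cat !word_prod_cons id_lfunE.
have := g1 (word_prod w y); rewrite gE word_prod_revK id_lfunE => <-.
by rewrite (rs_invol rs).
Qed.


Lemma exchange w i : (forall x, in_chamber x -> a i (word_prod w x) < 0) ->
  exists2 w', (size w' < size w)%N & word_prod (i :: w) = word_prod w'.
Proof.
elim/last_ind: w => [/=|w k IH] neg.
  have [c Cc] := rs_chamber rs.
  by have := neg c Cc; rewrite id_lfunE ltNge (ltW (Cc i)).
have [pos|/IH[w' w'w iw]] := chamber_sign w i.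
  exists w; first by rewrite size_rcons.
  apply/lfunP => x; rewrite word_prod_cons -(crossing pos neg) word_prod_cons.
  by rewrite (rs_invol rs).
exists (rcons w' k); first by rewrite !size_rcons.
apply/lfunP => x; rewrite -!cats1 word_prod_cons !word_prod_cat.
by rewrite -word_prod_cons iw.
Qed.

(* Induction on the length of a word: the wall [i] separates [C] from its image
   under [word_prod w], so by exchange [s i \o word_prod w] is shorter. *)
Lemma gallery_ind (P : 'End(V) -> Prop) : P \1%VF ->
  (forall w i, (forall x, in_closed_chamber x -> a i (word_prod w x) <= 0) ->
     P (s i \o word_prod w)%VF -> P (word_prod w)) ->
  forall w, P (word_prod w).
Proof.
move=> P1 Pi w; have [m] := ubnP (size w); elim: m w => // m IH w wm.
have [[i neg]|/forallNP npos] :=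
    pselect (exists i, forall x, in_chamber x -> a i (word_prod w x) < 0).
  apply: (Pi w i) => [x Cx|].
    rewrite -oppr_ge0; pose f : {scalar V} := \- a i \o word_prod w.
    rewrite -[X in 0 <= X]/(f x).
    by apply: closed_chamber_ge0 => // y Cy; rewrite /f/= oppr_gt0 neg.
  have [w' w'w iw] := exchange neg.
  rewrite -[X in P X]/(word_prod (i :: w)) iw.
  by apply: IH; apply: leq_trans w'w _.
have [c Cc] := rs_chamber rs; rewrite (rs_disjoint rs Cc)// => i.
by have [/(_ _ Cc)|/npos] := chamber_sign w i.
Qed.

(** * Faces meeting the closed chamber *)

Section Faces.
Variable Y : set V.
Hypotheses (coneY : convex_cone Y) (Y0 : Y 0).
Hypothesis YW : forall w, word_prod w @` Y = Y.
Hypothesis YX : forall y, Y y -> exists w, in_closed_chamber (word_prod w y).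

Definition standard_face F : Prop :=
  Fa Y F /\ exists2 x, cone_ri F x & in_closed_chamber x.

Definition face_type F : set 'I_n := [set i | s i @` F = F].

Local Notation WF F := (word_group (face_type F)).

Lemma word_image_cat w w' F :
  word_prod (w ++ w') @` F = word_prod w @` (word_prod w' @` F).
Proof.
by rewrite image_comp; apply: eq_imagel => x _; rewrite word_prod_cat.
Qed.

Lemma word_image_cons i w F :
  (s i \o word_prod w)%VF @` F = s i @` (word_prod w @` F).
Proof. by rewrite image_comp; apply: eq_imagel => x _; rewrite comp_lfunE. Qed.

Lemma image_id F : (\1%VF : 'End(V)) @` F = F.
Proof.
by rewrite -[RHS]image_id; apply: eq_imagel => x _; rewrite id_lfunE.
Qed.

Lemma word_group_face F f : WF F f -> f @` F = F.
Proof.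
move=> [w + <-]; elim: w => [_|i w IH wF]; first exact: image_id.
rewrite word_image_cons IH => [|j jw]; last by apply: wF; rewrite inE jw orbT.
by apply: wF; rewrite mem_head.
Qed.

Lemma Fa_word w F : Fa Y F -> Fa Y (word_prod w @` F).
Proof. by apply: Fa_image => //; exact: word_prod_revK. Qed.

Lemma face_type_ri F z i : Fa Y F -> cone_ri F z -> a i z = 0 ->
  face_type F i.
Proof.
move=> FF rz /(rs_fix rs) sz.
have E : s i = word_prod [:: i].
  by apply/lfunP => x; rewrite word_prod_cons id_lfunE.
apply: (@face_eq _ _ Y _ _ z) => //; first by rewrite E; exact: Fa_word.
by rewrite -sz; exact: cone_ri_image.
Qed.

Lemma face_type_separated F x y i : Fa Y F -> cone_ri F x -> F y ->
  0 <= a i x -> a i y <= 0 -> a i y < 0 \/ cone_ri F y -> face_type F i.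
Proof.
move=> FF rx Fy ix; rewrite le_eqVlt => /predU1P[iy [|ry]|iy _].
- by rewrite iy ltxx.
- exact: face_type_ri ry iy.
- have [[cF _ _] _] := FF.
  by have [z rz iz] := cone_ri_kernel cF rx Fy ix iy; apply: face_type_ri rz iz.
Qed.

Lemma standard_face_stab w F :
  standard_face F -> standard_face (word_prod w @` F) ->
  word_prod w @` F = F /\ WF F (word_prod w).
Proof.
move: F; pattern (word_prod w); apply: gallery_ind => {w}
  [F _ _|w i iw IH F sF swF].
  by rewrite image_id; split=> //; exists [::].
have [[FF [x rx Cx]] [FwF [y ry Cy]]] := (sF, swF).
have rwx := cone_ri_image (word_prod w) rx.
have iwF : face_type (word_prod w @` F) i.
  by apply: (face_type_separated FwF ry rwx.1 (Cy i) (iw _ Cx)); right.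
have E : (s i \o word_prod w)%VF @` F = word_prod w @` F.
  by rewrite word_image_cons.
have [|wF iwW] := IH F sF; first by rewrite E.
rewrite E in wF; split=> //; rewrite wF in iwF.
have -> : word_prod w = (s i \o (s i \o word_prod w))%VF.
  by apply/lfunP => z; rewrite !comp_lfunE (rs_invol rs).
exact: word_groupM (word_group_gen iwF) iwW.
Qed.

Lemma standard_face_sub w F F' :
  standard_face F -> standard_face F' -> word_prod w @` F `<=` F' ->
  F `<=` F' /\ exists2 v, WF F v & WF F' (word_prod w \o v)%VF.
Proof.
move=> + sF'; move: F; pattern (word_prod w); apply: gallery_ind => {w}
  [F _|w i iw IH F sF wFF'].
  rewrite image_id => FF'; split=> //.
  exists \1%VF; first by exists [::].
  by exists [::] => //; rewrite comp_lfun1l.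
have [[FF [x rx Cx]] [FF' [y ry Cy]]] := (sF, sF').
have rwx := cone_ri_image (word_prod w) rx.
have F'wx : F' (word_prod w x) by apply: wFF'; exact: rwx.1.
have [iwx|iwx] := eqVneq (a i (word_prod w x)) 0.
  have swF : s i @` (word_prod w @` F) = word_prod w @` F.
    exact: face_type_ri (Fa_word _ FF) rwx iwx.
  have [|FsubF' [v vF vF']] := IH F sF; first by rewrite word_image_cons swF.
  split=> //; pose g := rev w ++ i :: w.
  have gF : word_prod g @` F = F.
    rewrite word_image_cat word_image_cons swF -word_image_cat.
    rewrite -[RHS]image_id; apply: eq_imagel => z _.
    by rewrite word_prod_cat word_prod_revK id_lfunE.
  exists (word_prod g \o v)%VF.
    by apply: word_groupM => //; apply: (standard_face_stab _ _).2; rewrite ?gF.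
  suff -> : (word_prod w \o (word_prod g \o v))%VF = 
      ((s i \o word_prod w) \o v)%VF by [].
  apply/lfunP => z; rewrite !comp_lfunE word_prod_cat word_prodK_rev.
  by rewrite word_prod_cons.
have iF' : face_type F' i.
  apply: (face_type_separated FF' ry F'wx (Cy i) (iw _ Cx)).
  by left; rewrite lt_neqAle iwx iw.
have [|FsubF' [v vF vF']] := IH F sF.
  by rewrite word_image_cons -iF'; apply: image_subset.
split=> //; exists v => //.
have -> : (word_prod w \o v)%VF = (s i \o ((s i \o word_prod w) \o v))%VF.
  by apply/lfunP => z; rewrite !comp_lfunE (rs_invol rs).
exact: word_groupM (word_group_gen iF') vF'.
Qed.

Lemma exists_standard_face F : Fa Y F ->
  exists w, standard_face (word_prod w @` F).
Proof.
move=> FF; have [[cF FY _] _] := FF.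
have [x rx] := cone_ri_neq0 cF (face0 Y0 FF).
have [w Cwx] := YX (FY _ rx.1).
exists w; split; first exact: Fa_word.
by exists (word_prod w x) => //; exact: cone_ri_image.
Qed.

Lemma standard_face_top : standard_face Y.
Proof.
by have [w] := exists_standard_face (face_refl coneY Y0); rewrite YW.
Qed.

Lemma face_type_top : face_type Y = setT.
Proof.
apply/seteqP; split=> // i _; rewrite /face_type/= -[RHS](YW [:: i]).
by rewrite -[RHS]/((s i \o word_prod [::])%VF @` Y) word_image_cons image_id.
Qed.

Lemma standard_face_meet F F' : standard_face F -> standard_face F' ->
  exists G, is_meet standard_face subset F F' G.
Proof.
move=> sF sF'; have FI := faceI coneY Y0 sF.1 sF'.1.
have [w sG] := exists_standard_face FI.
exists (word_prod w @` (F `&` F')).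
have back : word_prod (rev w) @` (word_prod w @` (F `&` F')) = F `&` F'.
  rewrite -word_image_cat -[RHS]image_id; apply: eq_imagel => z _.
  by rewrite word_prod_cat word_prod_revK id_lfunE.
split=> //.
- by apply: (standard_face_sub (w := rev w) sG sF _).1; rewrite back => x [].
- by apply: (standard_face_sub (w := rev w) sG sF' _).1; rewrite back => x [].
- move=> Z sZ ZF ZF'; apply: (standard_face_sub (w := w) sZ sG _).1.
  by apply: image_subset => x Zx; split; [exact: ZF|exact: ZF'].
Qed.

Local Notation coset w F := [set (word_prod w \o f)%VF | f in WF F].

Lemma coset_face_bigcup w F :
  \bigcup_(f in coset w F) f @` F = word_prod w @` F.
Proof.
have cosetE f : WF F f -> (word_prod w \o f)%VF @` F = word_prod w @` F.
  move=> /word_group_face fF; rewrite -{2}fF image_comp.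
  by apply: eq_imagel => x _; rewrite comp_lfunE.
apply/seteqP; split=> x.
  by move=> [_ [f WFf <-]]; rewrite cosetE.
have W1 : WF F \1%VF by exists [::].
rewrite -(cosetE _ W1) => ?.
by exists (word_prod w \o \1)%VF => //; exists \1%VF.
Qed.

Lemma word_image_sub w w' F F' : word_prod w @` F `<=` word_prod w' @` F' ->
  word_prod (rev w' ++ w) @` F `<=` F'.
Proof.
move=> sub x [y Fy <-]; have [|z F'z e] := sub (word_prod w y).
  by exists y.
by rewrite word_prod_cat -e word_prod_revK.
Qed.

Lemma coset_face_le w w' F F' : standard_face F -> standard_face F' ->
  (F `<=` F' /\ coset w F `&`
    coset w' F' !=set0) <->
  word_prod w @` F `<=` word_prod w' @` F'.
Proof.
move=> sF sF'; split=> [[FF' [_ [[f WFf <-] [g WF'g e]]]]|].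
  move=> _ [x Fx <-]; have : (f @` F) x by rewrite (word_group_face WFf).
  move=> [y Fy <-]; rewrite -comp_lfunE -e comp_lfunE.
  exists (g y) => //; rewrite -(word_group_face WF'g).
  by exists y => //; exact: FF'.
move=> /word_image_sub/(standard_face_sub sF sF')[FF' [v WFv WF'v]].
split=> //; exists (word_prod w \o v)%VF; split; first by exists v.
exists (word_prod (rev w' ++ w) \o v)%VF => //.
by apply/lfunP => x; rewrite !comp_lfunE word_prod_cat word_prodK_rev.
Qed.

Lemma coset_face_inj w w' F F' : standard_face F -> standard_face F' ->
  word_prod w @` F = word_prod w' @` F' ->
  F = F' /\ coset w F = coset w' F'.
Proof.
move=> sF sF' e.
have eF : F = F'.
  apply/seteqP; split.
  - by apply: ((coset_face_le w w' sF sF').2 _).1; rewrite e.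
  - by apply: ((coset_face_le w' w sF' sF).2 _).1; rewrite e.
split=> //; subst F'; pose g := word_prod (rev w' ++ w).
have gF : g @` F = F.
  rewrite word_image_cat e -word_image_cat -[RHS]image_id.
  by apply: eq_imagel => x _; rewrite word_prod_cat word_prod_revK id_lfunE.
have WFg : WF F g by apply: (standard_face_stab sF _).2; rewrite gF.
have [k0 _ _ WV] := word_group_subgroup (face_type F).
have wE x : word_prod w x = word_prod w' (g x).
  by rewrite /g word_prod_cat word_prodK_rev.
apply/seteqP; split=> _ [f WFf <-].
  exists (g \o f)%VF; first exact: word_groupM.
  by apply/lfunP => x; rewrite !comp_lfunE wE.
exists (g^-1 \o f)%VF; first by apply: word_groupM => //; exact: WV.
by apply/lfunP => x; rewrite !comp_lfunE wE lker0_lfunVK// k0.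
Qed.

End Faces.
End ReflectionSystem.

(** * Linear Coxeter systems *)

Section CoxeterReflections.
Context {R : realType} {h : vectType R} {n : nat}.
Variables (H : 'I_n -> set h) (L : 'I_n -> set (dual h)).
Implicit Types (l : dual h) (i j : 'I_n).

Definition eval_at (v : h) l : R := l v.

Lemma eval_at_is_scalar v : scalar (eval_at v).
Proof. by move=> t l l'; rewrite /eval_at add_lfunE scale_lfunE. Qed.

HB.instance Definition _ v :=
  GRing.isLinear.Build R (dual h) R *%R (eval_at v) (eval_at_is_scalar v).

Variable v : 'I_n -> h.
Hypotheses (v0 : forall i, v i != 0)
  (HE : forall i, H i = [set t *: v i | t in [set t : R | 0 <= t]]).

Local Notation a := (fun i => eval_at (v i) : {scalar dual h}).

Lemma ray_eq0E i l : ray_eq0 (H i) l <-> a i l = 0.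
Proof.
rewrite /ray_eq0 HE; split=> [/(_ _ (ray_mem _))//|lv _ [t _ <-]].
by rewrite linearZ/= [l (v i)]lv scaler0.
Qed.

Lemma closed_chamberE : closed_chamber H = in_closed_chamber a.
Proof.
apply/seteqP; split=> l Cl i; last first.
  by move=> _ x; rewrite HE => -[t t0 <-]; rewrite linearZ mulr_ge0// Cl.
by apply: (Cl i I); rewrite HE; exact: ray_mem.
Qed.

Lemma chamberE : chamber H = in_chamber a.
Proof.
apply/seteqP; split=> l Cl i; last first.
  move=> _ x [+ x0]; rewrite HE => -[t t0 tx]; move: x0; rewrite -tx => x0.
  rewrite linearZ mulr_gt0//; last exact: Cl.
  rewrite lt_neqAle [0 <= t]t0 andbT; apply/eqP => te.
  by apply: x0; rewrite -te scale0r.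
by apply: (Cl i I); split; [rewrite HE; exact: ray_mem|exact/eqP].
Qed.

Hypothesis cox : linear_coxeter_system H L.

Lemma lcs_sigmaE i :
  exists2 m, 0 < a i m &
    forall l, sigma H L i l = l - (2 * (a i l / a i m)) *: m.
Proof.
have [m [m0 LE]] := lcs_rayL cox i.
have am : 0 < a i m.
  have : ray_gt0 (H i) m.
    by apply: (lcs_pos cox); split; [rewrite LE; exact: ray_mem|exact/eqP].
  by apply; split; [rewrite HE; exact: ray_mem|exact/eqP].
exists m => //; apply/is_reflectionE; first by rewrite gt_eqF.
have := reflectionP (lcs_rayH cox i) (lcs_rayL cox i)
  (@lcs_pos _ _ _ _ _ cox i).
by rewrite -LE -HE.
Qed.

Lemma lcs_exists_chamber : exists c, in_chamber a c.
Proof.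
have Ci i : exists2 l, in_closed_chamber a l & 0 < a i l.
  apply: contrapT => none.
  have [m am _] := lcs_sigmaE i.
  pose f := linfun (a i : {linear dual h -> R^o}).
  have : m \in lker f.
    rewrite (lcs_span cox (U := lker f)) ?memvf// => l.
    rewrite closed_chamberE memv_ker lfunE /= => Cl; apply/eqP.
    apply: contrapT => /eqP al; apply: none; exists l => //.
    by rewrite lt_neqAle eq_sym al Cl.
  by rewrite memv_ker lfunE/= gt_eqF.
have /choice[c cP] i : exists l, in_closed_chamber a l /\ 0 < a i l.
  by have [l] := Ci i; exists l.
exists (\sum_i c i) => i; rewrite linear_sum (bigD1 i)//=.
apply: ltr_pwDl; first exact: (cP i).2.
by apply: sumr_ge0 => j _; exact: (cP j).1.
Qed.

Lemma has_dim_spanE A d : A 0 -> has_dim A d ->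
  exists U : {vspace dual h}, [/\ \dim U = d, A `<=` [set u | u \in U] &
    forall f : {scalar dual h}, (forall x, A x -> f x = 0) ->
      forall u, u \in U -> f u = 0].
Proof.
move=> A0 [x [U [affE dU]]]; exists U.
have affA y : A y -> affine_hull A y.
  move=> Ay; exists 1%N, (fun=> 1), (fun=> y).
  by split=> //; rewrite big_ord1 ?scale1r.
have xU : x \in U.
  have := affA _ A0; rewrite affE => -[u uU /eqP].
  by rewrite addr_eq0 => /eqP ->; rewrite rpredN.
split=> // [y /affA|f fA u uU].
  by rewrite affE => -[u uU <-]; rewrite /= rpredD.
have : affine_hull A u.
  by rewrite affE; exists (u - x); [rewrite /= rpredB|rewrite addrC subrK].
move=> [m [c [p [Ap _ ->]]]]; rewrite linear_sum big1// => i _.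
by rewrite linearZ/= fA// mulr0.
Qed.

(* [wall i] has codimension 1, hence spans the kernel of [a i], so any other
   [a j] vanishing on it is proportional to [a i] and [wall j = wall i]. *)
Lemma lcs_exists_wall_point i :
  exists2 p, a i p = 0 & forall j, j != i -> 0 < a j p.
Proof.
have wallE j l : wall H j l <-> in_closed_chamber a l /\ a j l = 0.
  by rewrite /wall closed_chamberE; split=> -[Cl /ray_eq0E].
have wall0 : wall H i 0.
  by apply/wallE; split=> [j|]; rewrite linear0.
have : [set F | codim1_face (closed_chamber H) F] (wall H i).
  by rewrite -(lcs_walls cox); exists i.
move=> [_ [d [/(has_dim_spanE wall0)[U [dU wU Uf]]]]].
have [C0 _] := wall0.
move=> /(has_dim_spanE C0)[T [dT CT _]].
have {}dT : \dim {:dual h} = d.+1 by rewrite -(lcs_span cox (U := T)).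
have [m am _] := lcs_sigmaE i.
pose f := linfun (a i : {linear dual h -> R^o}).
have UE : U = lker f.
  apply/eqP; rewrite eqEdim; apply/andP; split.
    apply/subvP => u uU; rewrite memv_ker lfunE/=; apply/eqP.
    by apply: (Uf (a i)) => // x /wallE[].
  have := limg_ker_dim f fullv; rewrite capfv dT dU.
  have : (0 < \dim (f @: fullv))%N.
    rewrite lt0n dimv_eq0; apply/eqP => f0.
    have : f m \in (f @: fullv)%VS by rewrite memv_img ?memvf.
    by rewrite f0 memv0 lfunE/= gt_eqF.
  by move=> pos e; rewrite -ltnS -e -[ltnLHS]addn0 ltn_add2l.
have Cj j : j != i -> exists2 l, wall H i l & 0 < a j l.
  move=> ji; apply: contrapT => none.
  have jU u : a i u = 0 -> a j u = 0.
    move=> iu; apply: (Uf (a j)); last first.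
      by rewrite UE memv_ker lfunE/=; apply/eqP.
    move=> l wl; apply: contrapT => /eqP al; apply: none.
    exists l => //; have /wallE[/(_ j) jl _] := wl.
    by rewrite lt_neqAle; apply/andP; split=> //; rewrite eq_sym.
  have [c Cc] := lcs_exists_chamber.
  have prop l : a j l = a i l * (a j c / a i c).
    have : a j (l - (a i l / a i c) *: c) = 0.
      by apply: jU; rewrite linearB linearZ/= divfK ?subrr// gt_eqF// Cc.
    rewrite linearB linearZ/= => /eqP; rewrite subr_eq0 => /eqP ->; ring.
  move/eqP: ji; apply; apply: (lcs_wall_inj cox).
  apply/seteqP; split=> l /wallE[Cl al]; apply/wallE; split=> //; last first.
    by rewrite prop al mul0r.
  move/eqP: al; rewrite prop mulf_eq0 => /orP[/eqP//|].
  by rewrite gt_eqF// divr_gt0// Cc.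
have /choice[c cP] j : exists l, wall H i l /\ (j != i -> 0 < a j l).
  have [->|/Cj[l wl jl]] := eqVneq j i; last by exists l.
  by exists 0.
exists (\sum_j c j) => [|j ji]; rewrite linear_sum.
  by rewrite big1// => j _; have /wallE[] := (cP j).1.
rewrite (bigD1 j)//=; apply: ltr_pwDl; first exact: (cP j).2.
by apply: sumr_ge0 => k _; have /wallE[/(_ j)] := (cP k).1.
Qed.

Lemma lcs_reflection_system : reflection_system a (sigma H L).
Proof.
have opp i l : a i (sigma H L i l) = - a i l.
  have [m am ->] := lcs_sigmaE i.
  by rewrite linearB linearZ/=; field; rewrite gt_eqF.
have fix0 i l : a i l = 0 -> sigma H L i l = l.
  have [m am ->] := lcs_sigmaE i.
  by move=> ->; rewrite mul0r mulr0 scale0r subr0.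
have invol i l : sigma H L i (sigma H L i l) = l.
  have [m am E] := lcs_sigmaE i.
  by rewrite [LHS]E opp mulNr mulrN scaleNr opprK E subrK.
split=> //; [exact: lcs_exists_chamber|exact: lcs_exists_wall_point|].
move=> w l Cl Cwl; apply: contrapT => w1.
suff : (word_prod (sigma H L) w @` chamber H `&` chamber H)
    (word_prod (sigma H L) w l).
  rewrite (lcs_disjoint cox) => [[]||//]; rewrite /coxeter_group /parabolic.
  move=> M [[_ M1 MM _] sM]; elim: w {w1 Cwl} => [//|i w IH].
  by apply: MM => //; apply: sM; exists i.
by rewrite chamberE; split=> //; exists l.
Qed.

End CoxeterReflections.

Lemma lower_semilattice_with_top_iso T T' (A : set T) (B : set T')
    (le : T -> T -> Prop) (le' : T' -> T' -> Prop) (f : T -> T') (t : T) :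
  set_bij A B f -> (forall x y, A x -> A y -> (le x y <-> le' (f x) (f y))) ->
  A t -> lower_semilattice_with_top B le' (f t) ->
  lower_semilattice_with_top A le t.
Proof.
move=> [fB finj fsurj] fle At [[rf asym tr] meet Bt top]; split=> //.
- split=> [x Ax|x y Ax Ay|x y z Ax Ay Az].
  + by apply/fle => //; apply: rf; exact: fB.
  + move=> /(fle _ _ Ax Ay) xy /(fle _ _ Ay Ax) yx.
    by apply: finj; rewrite ?inE//; apply: asym => //; exact: fB.
  + move=> /(fle _ _ Ax Ay) xy /(fle _ _ Ay Az) yz.
    by apply/fle => //; apply: tr xy yz; exact: fB.
- move=> x y Ax Ay.
  have [_ [/fsurj[m Am <-] mx my mz]] := meet _ _ (fB _ Ax) (fB _ Ay).
  exists m; split=> //; try by apply/fle.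
  move=> z Az /(fle _ _ Az Ax) zx /(fle _ _ Az Ay) zy.
  by apply/fle => //; apply: mz => //; exact: fB.
- by move=> x Ax; apply/fle => //; apply: top; exact: fB.
Qed.

Lemma subset_partial_order T (B : set (set T)) : partial_order_on B subset.
Proof.
split=> [x _//|x y _ _ xy yx|x y z _ _ _]; first exact/seteqP.
exact: subset_trans.
Qed.

Lemma face_lattice (R : realType) (V : vectType R) (K : set V) :
  convex_cone K -> K 0 -> lower_semilattice_with_top (Fa K) subset K.
Proof.
move=> cK K0; split; first exact: subset_partial_order.
- move=> F F' FF FF'; exists (F `&` F'); split; first exact: faceI.
  + exact: subIsetl.
  + exact: subIsetr.
  + by move=> G _ GF GF'; rewrite subsetI.
- exact: face_refl.
- by move=> F [[]].
Qed.

Theorem corollary4p16 (R : realType) (h : vectType R) (n : nat)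
    (H : 'I_n -> set h) (L : 'I_n -> set (dual h))
    (hHL : linear_coxeter_system H L)
    (Y : set (dual h)) (hYcone : convex_cone Y) (hY0 : Y 0)
    (hYX : Y `<=` tits_cone H L)
    (hYW : forall s, coxeter_group H L s -> s @` Y = Y) :
  regular_type_map H L (Upsilon H Y) subset Y (upsilon H L) /\
  poset_isomorphic
    (type_poset H L (Upsilon H Y) (upsilon H L)) (type_poset_le subset)
    (Fa Y) subset.
Proof.
have [v vP] := choice (lcs_rayH hHL).
have v0 i : v i != 0 := (vP i).1.
have HE i := (vP i).2.
have rs := lcs_reflection_system v0 HE hHL.
pose a i : {scalar dual h} := eval_at (v i).
have parE J : parabolic H L J = word_group (sigma H L) J.
  exact: generated_groupE rs J.
have wW w : coxeter_group H L (word_prod (sigma H L) w).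
  by rewrite /coxeter_group parE; exists w.
have YW w : word_prod (sigma H L) w @` Y = Y by apply: hYW.
have YX y : Y y -> exists w, in_closed_chamber a (word_prod (sigma H L) w y).
  move=> /hYX[s]; rewrite /coxeter_group parE => -[w _ <-] [x Cx <-].
  exists (rev w); rewrite (word_prod_revK rs).
  by move: Cx; rewrite (closed_chamberE HE).
have UpsE : Upsilon H Y = standard_face a Y.
  have riE F : Fa Y F -> relative_interior F = cone_ri F.
    move=> FF; have [[cF _ _] _] := FF.
    by apply: relative_interiorE => //; exact: face0 FF.
  apply/seteqP; split=> F [FF].
    by rewrite riE// (closed_chamberE HE) => -[x [rx Cx]]; split=> //; exists x.
  move=> [x rx Cx]; split=> //; exists x.
  by rewrite riE// (closed_chamberE HE).
pose word := word_prod (sigma H L).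
pose coset w F := left_coset (word w)
  (word_group (sigma H L) (face_type (sigma H L) F)).
have typeE p : type_poset H L (Upsilon H Y) (upsilon H L) p <->
    standard_face a Y p.1 /\ exists w, p.2 = coset w p.1.
  rewrite /type_poset/= UpsE /coxeter_group !parE; split=> -[sp].
    by move=> [_ [w _ <-] ps]; split=> //; exists w.
  by move=> [w ps]; split=> //; exists (word w) => //; exists w.
pose phi (p : set (dual h) * set 'End(dual h)) := \bigcup_(f in p.2) f @` p.1.
have phiE p w : p.2 = coset w p.1 -> phi p = word w @` p.1.
  by rewrite /phi => ->; exact: coset_face_bigcup.
have phi_le p q : type_poset H L (Upsilon H Y) (upsilon H L) p ->
    type_poset H L (Upsilon H Y) (upsilon H L) q ->
    (type_poset_le subset p q <-> phi p `<=` phi q).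
  move=> /typeE[sp [w pE]] /typeE[sq [w' qE]].
  rewrite (phiE _ _ pE) (phiE _ _ qE) /type_poset_le pE qE.
  exact: (coset_face_le rs YW _ _ sp sq).
have phi_bij : set_bij (type_poset H L (Upsilon H Y) (upsilon H L)) (Fa Y) phi.
  split=> [p /typeE[sp [w pE]]|p q|F FF].
  - by rewrite (phiE _ _ pE); apply: (Fa_word rs YW); exact: sp.1.
  - rewrite !inE => /typeE[sp [w pE]] /typeE[sq [w' qE]].
    rewrite (phiE _ _ pE) (phiE _ _ qE) => /(coset_face_inj rs YW sp sq)[e1 e2].
    rewrite (surjective_pairing p) (surjective_pairing q) e1 pE qE.
    by congr (_, _); exact: e2.
  - have [w sF] := exists_standard_face rs hY0 YW YX FF.
    exists (word w @` F, coset (rev w) (word w @` F)).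
      by apply/typeE; split=> //; exists (rev w).
    rewrite (phiE _ (rev w))//= -word_image_cat -[RHS]image_id.
    apply: eq_imagel => x _.
    by rewrite word_prod_cat (word_prod_revK rs) id_lfunE.
have sY := standard_face_top rs hYcone hY0 YW YX.
have tY := face_type_top YW.
have cosetY : coset [::] Y = coxeter_group H L.
  rewrite /coset tY /coxeter_group parE; apply/seteqP; split=> f.
    by move=> [g Wg <-]; rewrite comp_lfun1l.
  by move=> Wf; exists f => //; rewrite comp_lfun1l.
have topA : type_poset H L (Upsilon H Y) (upsilon H L) (Y, coxeter_group H L).
  by apply/typeE; split=> //; exists [::].
split; last by exists phi.
split; last 1 first.
- apply: (lower_semilattice_with_top_iso phi_bij phi_le topA).
  have -> : phi (Y, coxeter_group H L) = Y.
    by rewrite (phiE _ [::])//= image_id.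
  exact: face_lattice.
- rewrite UpsE; split=> //; first exact: subset_partial_order.
    by move=> F F'; exact: (standard_face_meet rs hYcone hY0 YW YX).
  by move=> F [[[]]].
- exact: tY.
Qed.
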